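(* Let $\mathcal{H}$ be a finite-dimensional Hilbert space, $\{\rho_\theta;\theta\in\Theta\subset\mathbb{R}^2\}$ a smooth two-parameter family of density operators, $\theta_0\in\Theta$ with $\rho=\rho_{\theta_0}$ strictly positive, and suppose there exists a three-dimensional real subspace $\tilde{\mathcal{T}}$ of Hermitian operators with $\operatorname{span}_{\mathbb{R}}\{L_1^{(S)},L_2^{(S)}\}\subset\tilde{\mathcal{T}}$ and $\mathcal{D}_\rho(\tilde{\mathcal{T}})\subset\tilde{\mathcal{T}}$. Then for every $2\times2$ real positive matrix $G$, $$C^{(H)}_{\theta_0,G}=\max_{0\le\beta\le1}C^{(\beta)}_{\theta_0,G}=\begin{cases}C^{(1)}_{\theta_0,G}&\text{if }\hat\beta\ge1,\\ C^{(\hat\beta)}_{\theta_0,G}&\text{otherwise,}\end{cases}$$ where $\hat\beta=\dfrac{\operatorname{Tr}|\sqrt G\,\operatorname{Im}(J^{(R)}_{\theta_0})^{-1}\sqrt G|}{2\operatorname{Tr}G\{(J^{(S)}_{\theta_0})^{-1}-\operatorname{Re}((J^{(R)}_{\theta_0})^{-1})\}}$ if $(J^{(S)}_{\theta_0})^{-1}\ne\operatorname{Re}((J^{(R)}_{\theta_0})^{-1})$ and $\hat\beta=\infty$ otherwise.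
   Context: $\partial_i\rho=\frac{\partial}{\partial\theta^i}\rho_\theta|_{\theta=\theta_0}$. Commutation operator: $\mathcal{D}_\rho(X)\rho+\rho\mathcal{D}_\rho(X)=\sqrt{-1}(X\rho-\rho X)$. For $\beta\in[0,1]$, $L_i^{(\beta)}$ is defined by $\partial_i\rho=\frac{1+\beta}{2}\rho L_i^{(\beta)}+\frac{1-\beta}{2}L_i^{(\beta)}\rho$; $L_i^{(S)}=L_i^{(0)}$ (SLD, assumed linearly independent), $L_i^{(R)}=L_i^{(1)}$ (RLD). $J^{(\beta)}_{\theta_0}=[\operatorname{Tr}\partial_i\rho\,L_j^{(\beta)}]_{ij}$, $J^{(S)}=J^{(0)}$, $J^{(R)}=J^{(1)}$, $C^{(\beta)}_{\theta_0,G}=\operatorname{Tr}G(J^{(\beta)}_{\theta_0})^{-1}+\operatorname{Tr}|\sqrt G\,\operatorname{Im}(J^{(\beta)}_{\theta_0})^{-1}\sqrt G|$. Holevo bound: $C^{(H)}_{\theta_0,G}=\min_B\{\operatorname{Tr}GZ(B)+\operatorname{Tr}|\sqrt G\operatorname{Im}Z(B)\sqrt G|\}$ over Hermitian $B_1,B_2$ with $\operatorname{Tr}\partial_i\rho\,B_j=\delta_{ij}$, $Z_{ij}(B)=\operatorname{Tr}\rho B_jB_i$. Re, Im entrywise; $|X|=(X^*X)^{1/2}$. *)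

(* Defs.v *)
From HB Require Import structures.
From mathcomp Require Import all_boot all_order all_algebra.
From mathcomp Require Import all_classical all_reals all_analysis.
From mathcomp.real_closed Require Import complex.
Set Implicit Arguments. Unset Strict Implicit. Unset Printing Implicit Defensive.
Import Order.TTheory GRing.Theory Num.Theory.
Local Open Scope ring_scope.

(** Complex scalars are [R[i]] for [R : realType]; operators on the
    d-dimensional Hilbert space C^d are matrices ['M[R[i]]_d]. *)

Definition rC (R : realType) (x : R) : R[i] := Complex x 0.
Definition iC (R : realType) : R[i] := Complex 0 1.

Definition hadj (R : realType) m n (A : 'M[R[i]]_(m, n)) : 'M[R[i]]_(n, m) :=
  (map_mx Num.conj A)^T.

Definition is_herm (R : realType) d (A : 'M[R[i]]_d) : Prop := hadj A = A.

Definition psd (R : realType) d (A : 'M[R[i]]_d) : Prop :=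
  is_herm A /\ forall v : 'cV[R[i]]_d, 0 <= (hadj v *m A *m v) 0 0.

Definition posdef (R : realType) d (A : 'M[R[i]]_d) : Prop :=
  is_herm A /\ forall v : 'cV[R[i]]_d, v != 0 -> 0 < (hadj v *m A *m v) 0 0.

Definition density (R : realType) d (A : 'M[R[i]]_d) : Prop :=
  psd A /\ \tr A = 1.

Definition RtoC (R : realType) m n (A : 'M[R]_(m, n)) : 'M[R[i]]_(m, n) :=
  map_mx (@rC R) A.
Definition ReM (R : realType) m n (A : 'M[R[i]]_(m, n)) : 'M[R]_(m, n) :=
  map_mx (@complex.Re R) A.
Definition ImM (R : realType) m n (A : 'M[R[i]]_(m, n)) : 'M[R]_(m, n) :=
  map_mx (@complex.Im R) A.

Definition rpsd (R : realType) n (S : 'M[R]_n) : Prop :=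
  S^T = S /\ forall v : 'cV[R]_n, 0 <= (v^T *m S *m v) 0 0.
Definition rposdef (R : realType) n (S : 'M[R]_n) : Prop :=
  S^T = S /\ forall v : 'cV[R]_n, v != 0 -> 0 < (v^T *m S *m v) 0 0.

(** the (unique) positive semidefinite square root of a real PSD matrix *)
Definition msqrt (R : realType) n (S : 'M[R]_n) : 'M[R]_n :=
  xget 0 [set P | rpsd P /\ P *m P = S].

Definition trnorm (R : realType) n (X : 'M[R]_n) : R := \tr (msqrt (X^T *m X)).

Definition shift2 (R : realType) (th0 : R * R) (i : 'I_2) (t : R) : R * R :=
  if i == ord0 then (th0.1 + t, th0.2) else (th0.1, th0.2 + t).

Definition has_partial (R : realType) d (rho : R * R -> 'M[R[i]]_d)
    (th0 : R * R) (i : 'I_2) (D : 'M[R[i]]_d) : Prop :=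
  forall j k : 'I_d,
    is_derive (0 : R) (1 : R)
      (fun t => complex.Re (rho (shift2 th0 i t) j k)) (complex.Re (D j k)) /\
    is_derive (0 : R) (1 : R)
      (fun t => complex.Im (rho (shift2 th0 i t) j k)) (complex.Im (D j k)).

Definition Lbeta (R : realType) d (rho : 'M[R[i]]_d) (D : 'I_2 -> 'M[R[i]]_d)
    (beta : R) (i : 'I_2) : 'M[R[i]]_d :=
  xget 0 [set L | D i = rC ((1 + beta) / 2) *: (rho *m L)
                      + rC ((1 - beta) / 2) *: (L *m rho)].

Definition Jbeta (R : realType) d (rho : 'M[R[i]]_d) (D : 'I_2 -> 'M[R[i]]_d)
    (beta : R) : 'M[R[i]]_2 :=
  \matrix_(i < 2, j < 2) \tr (D i *m Lbeta rho D beta j).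

Definition Cbeta (R : realType) d (G : 'M[R]_2) (rho : 'M[R[i]]_d)
    (D : 'I_2 -> 'M[R[i]]_d) (beta : R) : R :=
  let Ji := invmx (Jbeta rho D beta) in
  complex.Re (\tr (RtoC G *m Ji)) + trnorm (msqrt G *m ImM Ji *m msqrt G).

Definition Dcomm (R : realType) d (rho X : 'M[R[i]]_d) : 'M[R[i]]_d :=
  xget 0 [set Y | Y *m rho + rho *m Y = iC R *: (X *m rho - rho *m X)].

Definition in_rspan (R : realType) d n (T : 'I_n -> 'M[R[i]]_d) (X : 'M[R[i]]_d)
  : Prop := exists c : 'I_n -> R, X = \sum_(k < n) rC (c k) *: T k.
Definition rlin_indep (R : realType) d n (T : 'I_n -> 'M[R[i]]_d) : Prop :=
  forall c : 'I_n -> R, \sum_(k < n) rC (c k) *: T k = 0 -> forall k, c k = 0.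

Definition Zmat (R : realType) d (rho : 'M[R[i]]_d) (B : 'I_2 -> 'M[R[i]]_d)
  : 'M[R[i]]_2 := \matrix_(i < 2, j < 2) \tr (rho *m B j *m B i).

Definition holevo_feasible (R : realType) d (D : 'I_2 -> 'M[R[i]]_d)
    (B : 'I_2 -> 'M[R[i]]_d) : Prop :=
  (forall j, is_herm (B j)) /\
  forall i j, \tr (D i *m B j) = (i == j)%:R.

Definition holevo_obj (R : realType) d (G : 'M[R]_2) (rho : 'M[R[i]]_d)
    (B : 'I_2 -> 'M[R[i]]_d) : R :=
  let Z := Zmat rho B in
  complex.Re (\tr (RtoC G *m Z)) + trnorm (msqrt G *m ImM Z *m msqrt G).

Definition is_holevo_bound (R : realType) d (G : 'M[R]_2) (rho : 'M[R[i]]_d)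
    (D : 'I_2 -> 'M[R[i]]_d) (c : R) : Prop :=
  (exists B, holevo_feasible D B /\ holevo_obj G rho B = c) /\
  (forall B, holevo_feasible D B -> c <= holevo_obj G rho B).

Definition betahat_finite (R : realType) d (rho : 'M[R[i]]_d)
    (D : 'I_2 -> 'M[R[i]]_d) : bool :=
  invmx (Jbeta rho D 0) != RtoC (ReM (invmx (Jbeta rho D 1))).

Definition betahat (R : realType) d (G : 'M[R]_2) (rho : 'M[R[i]]_d)
    (D : 'I_2 -> 'M[R[i]]_d) : R :=
  let JRi := invmx (Jbeta rho D 1) in
  trnorm (msqrt G *m ImM JRi *m msqrt G) /
  (2 * complex.Re (\tr (RtoC G *m (invmx (Jbeta rho D 0) - RtoC (ReM JRi))))).

(** the beta at which the case formula evaluates C^(beta):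
    1 if beta-hat >= 1 (including beta-hat = oo), beta-hat otherwise *)
Definition betastar (R : realType) d (G : 'M[R]_2) (rho : 'M[R[i]]_d)
    (D : 'I_2 -> 'M[R[i]]_d) : R :=
  if betahat_finite rho D && (betahat G rho D < 1) then betahat G rho D else 1.

(* Main.v *)
Require Import Defs.
From HB Require Import structures.
From mathcomp Require Import all_boot all_order all_algebra.
From mathcomp Require Import all_classical all_reals all_analysis.
From mathcomp.real_closed Require Import complex.
From mathcomp Require Import ring lra.
Set Implicit Arguments. Unset Strict Implicit. Unset Printing Implicit Defensive.
Import Order.TTheory GRing.Theory Num.Theory numFieldNormedType.Exports.
Local Open Scope ring_scope.

(** Write [Lam_b X = (1+b)/2 rho X + (1-b)/2 X rho], so that [L^(b)] is
    [Lam_b^-1] of the derivatives, and [Lam_b X = Lam_0 (X + i b D_rho(X))].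
    In the three-dimensional invariant space take the basis [E_0, E_1] of the
    span of the SLDs dual to [L^(S)], and a unit vector [E3] orthogonal to it for
    the SLD inner product. With [W = Z(E)] and [q_k = Im Tr rho E3 E_k], the
    operators [F_k = E_k + i b q_k E3] satisfy
    [Lam_b F_k = sum_j N_jk d_j rho] and [Tr (d_i rho) F_k = delta_ik] for
    [N = Re W + i b Im W - b^2 q q^T]; hence [N] is the inverse of [J^(b)], and
    [C^(b) = kappa - b^2 a + 2 b h] where [kappa = Tr G (Re W)], [a = q^T G q] and
    [h = sqrt (det G) |Im W_01|]. This parabola is maximal at [min (h / a) 1].

    For feasible [B], the matrix [Re Z(B) + i b Im Z(B) - N] is the Gram matrix of
    the [B_k - F_k] for the positive form [Tr X^* Lam_b Y], and the Holevo
    functional is monotone for the positive semidefinite order, so every [C^(b)]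
    is a lower bound. At the optimal [b] it is attained by [B_k = E_k + t_k E3]
    for a suitable real [t]. *)

(** * Two-element indices and two-by-two matrices, entrywise *)

Lemma ord2_ind (P : 'I_2 -> Prop) : P 0 -> P 1 -> forall i, P i.
Proof.
move=> P0 P1 [[|[|//]] i_lt].
- by rewrite (_ : Ordinal _ = 0) //; apply: val_inj.
- by rewrite (_ : Ordinal _ = 1) //; apply: val_inj.
Qed.

Lemma sum_ord2 (V : nmodType) (F : 'I_2 -> V) : \sum_(i < 2) F i = F 0 + F 1.
Proof.
rewrite !big_ord_recl big_ord0 addr0; congr (_ + F _); exact: val_inj.
Qed.

Lemma mxE2 (R : pzSemiRingType) (A B : 'M[R]_2) i j :
  (A *m B) i j = A i 0 * B 0 j + A i 1 * B 1 j.
Proof. by rewrite mxE sum_ord2. Qed.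

Lemma mx2P (R : Type) (A B : 'M[R]_2) :
  A 0 0 = B 0 0 -> A 0 1 = B 0 1 -> A 1 0 = B 1 0 -> A 1 1 = B 1 1 -> A = B.
Proof.
move=> A00 A01 A10 A11; apply/matrixP.
by elim/ord2_ind; elim/ord2_ind.
Qed.

(** * Real two-by-two matrices: positivity, square roots, trace norm *)

Section RealTwoByTwo.
Variable R : realType.
Implicit Types G P X : 'M[R]_2.

Definition det2 G : R := G 0 0 * G 1 1 - G 0 1 * G 1 0.

Lemma quad_form2 G (v : 'cV[R]_2) : (v^T *m G *m v) 0 0 =
  G 0 0 * v 0 0 ^+ 2 + (G 0 1 + G 1 0) * (v 0 0 * v 1 0) + G 1 1 * v 1 0 ^+ 2.
Proof. by rewrite !mxE sum_ord2 !mxE !sum_ord2 !mxE; ring. Qed.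

Lemma symmetric2 G : G^T = G -> G 1 0 = G 0 1.
Proof. by move/matrixP/(_ 0 1); rewrite mxE. Qed.

Lemma symmetric2P G : G 1 0 = G 0 1 -> G^T = G.
Proof. by move=> h; apply: mx2P; rewrite mxE. Qed.

Definition cvec2 (x y : R) : 'cV[R]_2 := \col_i (if i == 0 then x else y).

Lemma quad_form_cvec2 G x y : ((cvec2 x y)^T *m G *m cvec2 x y) 0 0 =
  G 0 0 * x ^+ 2 + (G 0 1 + G 1 0) * (x * y) + G 1 1 * y ^+ 2.
Proof. by rewrite quad_form2 !mxE. Qed.

Lemma cvec2_neq0 x y : (x != 0) || (y != 0) -> cvec2 x y != 0.
Proof.
move=> xy; apply/eqP => /matrixP h; move: (h 0 0) (h 1 0) xy.
by rewrite !mxE /= => -> ->; rewrite eqxx.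
Qed.

Lemma rposdef2 G : rposdef G ->
  [/\ G 1 0 = G 0 1, 0 < G 0 0, 0 < G 1 1 & 0 < det2 G].
Proof.
case=> /symmetric2 sG posG.
have := posG (cvec2 1 0); rewrite cvec2_neq0 ?oner_eq0// quad_form_cvec2.
rewrite expr0n mulr0 expr1n !mulr0 !addr0 mulr1 => /(_ isT) G00.
have := posG (cvec2 0 1); rewrite cvec2_neq0 ?oner_eq0 ?orbT// quad_form_cvec2.
rewrite expr0n mul0r expr1n !mulr0 !add0r mulr1 => /(_ isT) G11.
split=> //.
(* On this vector the form takes the value [G 0 0 * det2 G]. *)
have := posG (cvec2 (- G 0 1) (G 0 0)).
rewrite cvec2_neq0 ?(gt_eqF G00) ?orbT// quad_form_cvec2 sG => /(_ isT).
rewrite (_ : _ + _ = G 0 0 * det2 G); first by rewrite pmulr_rgt0.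
by rewrite /det2 sG; ring.
Qed.

(** Completing the square: [P 0 0] times the form is a square plus [det2 P] times a square. If
    [P 0 0 = 0], the determinant condition forces the off-diagonal entry to vanish. *)
Lemma rpsd2P P : P 1 0 = P 0 1 -> 0 <= P 0 0 -> 0 <= P 1 1 -> 0 <= det2 P ->
  rpsd P.
Proof.
move=> sP P00 P11; rewrite /det2 sP => dP; split; first exact: symmetric2P.
move=> v; rewrite quad_form2 sP.
set x := v 0 0; set y := v 1 0.
have [P00z|P00z] := eqVneq (P 0 0) 0.
  have -> : P 0 1 = 0.
    by apply/eqP; rewrite -sqrf_eq0; move: dP; rewrite P00z; nra.
  by rewrite P00z; nra.
have {P00z}P00 : 0 < P 0 0 by rewrite lt_def P00z.
rewrite -(pmulr_rge0 _ P00).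
rewrite [leRHS](_ : _ = (P 0 0 * x + P 0 1 * y) ^+ 2
  + (P 0 0 * P 1 1 - P 0 1 * P 0 1) * y ^+ 2); last by ring.
by rewrite addr_ge0 ?sqr_ge0// mulr_ge0 ?sqr_ge0.
Qed.

(* Cayley-Hamilton: P^2 = tr P * P - det P, solved for P. *)
Lemma msqrt2P G : rposdef G -> rpsd (msqrt G) /\ msqrt G *m msqrt G = G.
Proof.
move=> /rposdef2[sG G00 G11 dG].
apply: (@xgetPex _ _ [set P | rpsd P /\ P *m P = G]).
set g := Num.sqrt (det2 G).
have g0 : 0 < g by rewrite sqrtr_gt0.
have gE : g ^+ 2 = det2 G by rewrite sqr_sqrtr// ltW.
set t := Num.sqrt (G 0 0 + G 1 1 + 2 * g).
have t20 : 0 < G 0 0 + G 1 1 + 2 * g by rewrite !addr_gt0// mulr_gt0.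
have t0 : 0 < t by rewrite sqrtr_gt0.
have tE : t ^+ 2 = G 0 0 + G 1 1 + 2 * g by rewrite sqr_sqrtr// ltW.
have t_neq0 : t != 0 by rewrite gt_eqF.
exists (t^-1 *: (G + g%:M)); split.
  apply: rpsd2P; rewrite /det2 !mxE/= ?mulr1n ?mulr0n ?addr0 ?sG//.
  - by rewrite mulr_ge0 ?invr_ge0 ?addr_ge0// ltW.
  - by rewrite mulr_ge0 ?invr_ge0 ?addr_ge0// ltW.
  - rewrite (_ : _ - _ = t^-1 ^+ 2 * (det2 G + g * (G 0 0 + G 1 1) + g ^+ 2)).
      apply: mulr_ge0; first exact: sqr_ge0.
      apply: addr_ge0; last exact: sqr_ge0.
      apply: addr_ge0; first exact: ltW.
      by apply: mulr_ge0; [exact: ltW|apply: addr_ge0; exact: ltW].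
    by rewrite /det2 sG; ring.
rewrite -scalemxAl -scalemxAr scalerA.
have -> : (G + g%:M) *m (G + g%:M) = t ^+ 2 *: G.
  move: gE; rewrite tE /det2 sG => gE.
  apply: mx2P; rewrite mxE2 !mxE/= ?mulr1n ?mulr0n ?addr0 ?sG; nra.
by rewrite scalerA -expr2 -exprMn mulVf// expr1n scale1r.
Qed.

(** As [msqrt] is a choice, its value is known only through uniqueness. For any positive
    semidefinite root, the off-diagonal entry times the trace is zero, and a zero trace kills that
    entry too by positivity on (1, 1) and (1, -1). *)
Lemma msqrt_sqr_scalar (y : R) : msqrt ((y ^+ 2)%:M : 'M[R]_2) = `|y|%:M.
Proof.
apply: xget_unique => [|P [[/symmetric2 sP psdP] PP]].
  split; last by rewrite -scalar_mxM -expr2 real_normK ?num_real.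
  by apply: rpsd2P; rewrite /det2 !mxE/= ?mulr0n ?mulr1n ?mulr0 ?subr0 ?mulr_ge0.
have := psdP (cvec2 1 0); have := psdP (cvec2 0 1).
have := psdP (cvec2 1 1); have := psdP (cvec2 1 (-1)).
rewrite !quad_form_cvec2 sP => p1 p2 p3 p4.
have [P00 P11] : 0 <= P 0 0 /\ 0 <= P 1 1 by split; lra.
move/matrixP: PP => PP.
have := PP 0 0; have := PP 0 1; have := PP 1 1.
rewrite !mxE2 !mxE/= sP ?mulr0n ?mulr1n => e11 e01 e00.
have P01 : P 0 1 = 0.
  have /eqP : P 0 1 * (P 0 0 + P 1 1) = 0 by rewrite -e01; ring.
  rewrite mulf_eq0 => /orP[/eqP//|/eqP h]; lra.
have normE z : 0 <= z -> z * z = y ^+ 2 -> z = `|y|.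
  by move=> z0 zE; rewrite -sqrtr_sqr -zE -expr2 sqrtr_sqr ger0_norm.
move: e11 e00; rewrite P01 !mulr0 addr0 add0r => e11 e00.
apply: mx2P; rewrite ?sP ?P01 !mxE/= ?mulr0n ?mulr1n //; exact: normE.
Qed.

(** For [P] symmetric and [X] skew, [P X P = (det P) X], so its modulus is the scalar matrix
    [|det P * X 0 1|]; moreover [|det P|] is the square root of [det2 G]. *)
Lemma trnorm_skew G X : rposdef G -> X^T = - X ->
  trnorm (msqrt G *m X *m msqrt G) = 2 * Num.sqrt (det2 G) * `|X 0 1|.
Proof.
move=> posG /matrixP skX; have [[/symmetric2 sP _] PP] := msqrt2P posG.
move: sP PP; set P := msqrt G => sP PP.
have := skX 0 0; have := skX 1 1; have := skX 0 1; rewrite !mxE => X10 X11 X00.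
have {}X11 : X 1 1 = 0 by lra.
have {}X00 : X 0 0 = 0 by lra.
pose x := X 0 1; pose y := det2 P * x.
have PXP : (P *m X *m P)^T *m (P *m X *m P) = (y ^+ 2)%:M.
  have e : P *m X *m P = \matrix_(i, j) (if i == j then 0 else
     if i == 0 then y else - y).
    apply: mx2P; rewrite !mxE2 !mxE ?X10 ?X00 ?X11 ?sP /y /det2 ?sP /x /=; ring.
  by rewrite e; apply: mx2P; rewrite !mxE2 !mxE /= ?mulr0n ?mulr1n; ring.
rewrite /trnorm PXP msqrt_sqr_scalar mxtrace_scalar mulr2n.
have -> : Num.sqrt (det2 G) = `|det2 P|.
  rewrite -sqrtr_sqr; congr Num.sqrt.
  by rewrite -PP /det2 !mxE2 sP; ring.
by rewrite /y normrM /x; ring.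
Qed.

End RealTwoByTwo.

(** * Adjoints, Hermitian operators and traces *)

Section Adjoint.
Variable R : realType.
Local Notation C := R[i].

Lemma rCE (x : R) : rC x = real_complex R x. Proof. by []. Qed.

Lemma conj_rC (x : R) : Num.conj (rC x) = rC x.
Proof. exact: conjc_real. Qed.

Lemma sqr_iC : iC R * iC R = -1.
Proof. exact: sqr_i. Qed.

Lemma Complex_rC (x y : R) : Complex x y = rC x + iC R * rC y.
Proof. by rewrite [LHS]complexE. Qed.

Lemma hadjM m n p (A : 'M[C]_(m, n)) (B : 'M[C]_(n, p)) :
  hadj (A *m B) = hadj B *m hadj A.
Proof. by rewrite /hadj map_mxM trmx_mul. Qed.

Lemma hadjD m n (A B : 'M[C]_(m, n)) : hadj (A + B) = hadj A + hadj B.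
Proof. by rewrite /hadj map_mxD linearD. Qed.

Lemma hadjB m n (A B : 'M[C]_(m, n)) : hadj (A - B) = hadj A - hadj B.
Proof. by rewrite /hadj map_mxB linearB. Qed.

Lemma hadjZ m n a (A : 'M[C]_(m, n)) : hadj (a *: A) = Num.conj a *: hadj A.
Proof. by apply/matrixP => i j; rewrite !mxE rmorphM. Qed.

Lemma hadj_sum m n (I : finType) (F : I -> 'M[C]_(m, n)) :
  hadj (\sum_i F i) = \sum_i hadj (F i).
Proof.
apply/matrixP => i j; rewrite !mxE !summxE rmorph_sum.
by under [RHS]eq_bigr do rewrite !mxE.
Qed.

Lemma hadjK m n (A : 'M[C]_(m, n)) : hadj (hadj A) = A.
Proof. by apply/matrixP => i j; rewrite !mxE conjCK. Qed.

Lemma mxtrace_hadj n (A : 'M[C]_n) : \tr (hadj A) = Num.conj (\tr A).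
Proof. by rewrite /mxtrace rmorph_sum; apply: eq_bigr => i _; rewrite !mxE. Qed.

Lemma hermD n (A B : 'M[C]_n) : is_herm A -> is_herm B -> is_herm (A + B).
Proof. by rewrite /is_herm hadjD => -> ->. Qed.

Lemma hermZ n (x : R) (A : 'M[C]_n) : is_herm A -> is_herm (rC x *: A).
Proof. by rewrite /is_herm hadjZ conj_rC => ->. Qed.

Lemma herm_rspan d n (T : 'I_n -> 'M[C]_d) X :
  (forall k, is_herm (T k)) -> in_rspan T X -> is_herm X.
Proof.
move=> hT [c ->]; rewrite /is_herm hadj_sum; apply: eq_bigr => k _.
exact: hermZ.
Qed.

(** The trace is the sum of the quadratic form of [A] over the columns of [X], at least one of which
    is nonzero. *)
Lemma posdef_mxtrace_gt0 d n (A : 'M[C]_d) (X : 'M[C]_(d, n)) :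
  posdef A -> X != 0 -> 0 < \tr (hadj X *m A *m X).
Proof.
move=> [_ posA] X0.
have entry j : (hadj X *m A *m X) j j =
    (hadj (col j X) *m A *m col j X) 0 0.
  rewrite !mxE; apply: eq_bigr => k _; rewrite !mxE; congr (_ * _).
  by apply: eq_bigr => l _; rewrite !mxE.
have [j colj] : exists j, col j X != 0.
  apply: contrapT => /forallNP noj; move/eqP: X0; apply.
  apply/matrixP => i j; have /negP := noj j; rewrite negbK => /eqP.
  by move/matrixP/(_ i 0); rewrite !mxE.
rewrite /mxtrace (bigD1 j) //= entry ltr_pwDl ?posA// sumr_ge0// => k _.
rewrite entry; have [->|/posA/ltW//] := eqVneq (col k X) 0.
by rewrite mulmx0 mxE.
Qed.

End Adjoint.

Lemma mxtraceB (R : pzRingType) n (A B : 'M[R]_n) : \tr (A - B) = \tr A - \tr B.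
Proof. exact: (raddfB (@mxtrace R n)). Qed.

Lemma mxtrace_sum (R : pzRingType) n m (A : 'I_m -> 'M[R]_n) :
  \tr (\sum_k A k) = \sum_k \tr (A k).
Proof. exact: (raddf_sum (@mxtrace R n)). Qed.

Lemma mxtrace_mulBB (R : pzRingType) m n (A B : 'M[R]_(m, n)) (X Y : 'M[R]_(n, m)) :
  \tr ((A - B) *m (X - Y)) =
  \tr (A *m X) - \tr (A *m Y) - \tr (B *m X) + \tr (B *m Y).
Proof. by rewrite mulmxBl !mulmxBr !mxtraceB opprB !addrA addrAC. Qed.

Lemma two_sided_mulmxD (R : pzRingType) n (a b : R) (P X Y : 'M[R]_n) :
  a *: (P *m (X + Y)) + b *: ((X + Y) *m P) =
  (a *: (P *m X) + b *: (X *m P)) + (a *: (P *m Y) + b *: (Y *m P)).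
Proof. by rewrite mulmxDr mulmxDl !scalerDr addrACA. Qed.

(** * The operator [Lam] and its positive form; logarithmic derivatives *)

Definition Lam (R : realType) d (rho : 'M[R[i]]_d) (b : R) (X : 'M[R[i]]_d) :=
  rC ((1 + b) / 2) *: (rho *m X) + rC ((1 - b) / 2) *: (X *m rho).

Section LamLinear.
Variables (R : realType) (d : nat) (rho : 'M[R[i]]_d) (b : R).
Implicit Types X Y : 'M[R[i]]_d.

Lemma LamD X Y : Lam rho b (X + Y) = Lam rho b X + Lam rho b Y.
Proof. exact: two_sided_mulmxD. Qed.

Lemma LamZ a X : Lam rho b (a *: X) = a *: Lam rho b X.
Proof.
by rewrite /Lam -scalemxAr -scalemxAl scalerDr !scalerA ![a * _]mulrC.
Qed.

Lemma Lam0 : Lam rho b 0 = 0.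
Proof. by rewrite /Lam mulmx0 mul0mx !scaler0 addr0. Qed.

Lemma LamB X Y : Lam rho b (X - Y) = Lam rho b X - Lam rho b Y.
Proof. by rewrite -[- Y]scaleN1r LamD LamZ scaleN1r. Qed.

Lemma Lam_sum n (a : 'I_n -> R[i]) (V : 'I_n -> 'M[R[i]]_d) :
  Lam rho b (\sum_k a k *: V k) = \sum_k a k *: Lam rho b (V k).
Proof.
by rewrite (big_morph (Lam rho b) LamD Lam0); apply: eq_bigr => k _; exact: LamZ.
Qed.

Fact Lam_is_linear : linear (Lam rho b).
Proof. by move=> a X Y; rewrite LamD LamZ. Qed.
HB.instance Definition _ :=
  GRing.isLinear.Build R[i] 'M[R[i]]_d 'M[R[i]]_d *:%R (Lam rho b) Lam_is_linear.

End LamLinear.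

Definition Lam_form (R : realType) d (rho : 'M[R[i]]_d) (b : R) X Y : R[i] :=
  \tr (hadj X *m Lam rho b Y).

Section LogarithmicDerivative.
Variables (R : realType) (d : nat) (rho : 'M[R[i]]_d) (b : R).
Hypotheses (rho_pos : posdef rho) (b01 : 0 <= b <= 1).
Implicit Types X Y : 'M[R[i]]_d.

Lemma Lam_formE X Y : Lam_form rho b X Y =
  rC ((1 + b) / 2) * \tr (hadj X *m rho *m Y) +
  rC ((1 - b) / 2) * \tr (hadj X *m Y *m rho).
Proof. by rewrite /Lam_form mulmxDr -!scalemxAr mxtraceD !mxtraceZ !mulmxA. Qed.

Lemma Lam_form_conj X Y : Num.conj (Lam_form rho b X Y) = Lam_form rho b Y X.
Proof.
rewrite !Lam_formE rmorphD !rmorphM/= -!mxtrace_hadj !conj_rC !hadjM hadjK.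
by rewrite rho_pos.1 [\tr (rho *m _)]mxtrace_mulC !mulmxA.
Qed.

(** Strictness comes from the first term, whose weight [(1 + b) / 2] is positive; the second weight
    may vanish, at [b = 1]. *)
Lemma Lam_form_gt0 X : X != 0 -> 0 < Lam_form rho b X X.
Proof.
move=> X0; rewrite Lam_formE.
have p1 := posdef_mxtrace_gt0 rho_pos X0.
have X'0 : hadj X != 0.
  by apply: contra X0 => /eqP h; rewrite -[X]hadjK h /hadj map_mx0 trmx0.
have p2 := posdef_mxtrace_gt0 rho_pos X'0.
(* Cyclicity turns positivity at [hadj X] into positivity of the second trace. *)
rewrite hadjK -mulmxA mxtrace_mulC -mulmxA mxtrace_mulC in p2.
case/andP: b01 => b0 b1.
apply: ltr_pwDl; [apply: mulr_gt0 => //|apply: mulr_ge0; last exact: ltW].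
- by rewrite rCE ltcR divr_gt0 // ltr_pwDl.
- by rewrite rCE lecR divr_ge0// subr_ge0.
Qed.

Lemma Lam_form_ge0 X : 0 <= Lam_form rho b X X.
Proof.
have [->|/Lam_form_gt0/ltW//] := eqVneq X 0.
by rewrite /Lam_form Lam0 mulmx0 mxtrace0.
Qed.

Lemma Lam_eq0 X : Lam rho b X = 0 -> X = 0.
Proof.
move=> LX; apply/eqP/negP => /negP /Lam_form_gt0.
by rewrite /Lam_form LX mulmx0 mxtrace0 ltxx.
Qed.

Lemma Lam_inj : injective (Lam rho b).
Proof.
move=> X Y /eqP; rewrite -subr_eq0 -LamB => /eqP/Lam_eq0/eqP.
by rewrite subr_eq0 => /eqP.
Qed.

(** Injectivity suffices in finite dimension; it is transported to the matrix of [Lam] on vectorised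
    operators. *)
Lemma Lam_surj Y : exists X, Lam rho b X = Y.
Proof.
pose M := lin_mx (Lam rho b).
have uM : M \in unitmx.
  rewrite -row_free_unit; apply: inj_row_free => v.
  rewrite -[v]vec_mxK mul_vec_lin => /(congr1 vec_mx).
  by rewrite mxvecK linear0 => /Lam_eq0 ->; rewrite linear0.
exists (vec_mx (mxvec Y *m invmx M)).
apply: (can_inj mxvecK); rewrite -mul_vec_lin vec_mxK -mulmxA mulVmx//.
by rewrite mulmx1.
Qed.

(** Surjectivity makes the set behind [Lbeta] nonempty, so the default 0 of [xget] is never taken
    for lack of a solution. *)
Lemma Lam_Lbeta (D : 'I_2 -> 'M[R[i]]_d) i : Lam rho b (Lbeta rho D b i) = D i.
Proof.
apply/esym.
apply: (@xgetPex _ _ [set L | D i = rC ((1 + b) / 2) *: (rho *m L)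
                      + rC ((1 - b) / 2) *: (L *m rho)]).
by have [X <-] := Lam_surj (D i); exists X.
Qed.

Lemma gram_psd n (V : 'I_n -> 'M[R[i]]_d) :
  psd (\matrix_(j < n, k < n) Lam_form rho b (V j) (V k)).
Proof.
split; first by apply/matrixP => j k; rewrite !mxE Lam_form_conj.
move=> v; set W := \sum_j v j 0 *: V j.
rewrite (_ : _ 0 0 = Lam_form rho b W W); first exact: Lam_form_ge0.
rewrite {2}/W /Lam_form Lam_sum mulmx_sumr mxtrace_sum mxE.
apply: eq_bigr => k _; rewrite -scalemxAr mxtraceZ mulrC; congr (_ * _).
rewrite mxE /W hadj_sum mulmx_suml mxtrace_sum.
by apply: eq_bigr => j _; rewrite hadjZ -scalemxAl mxtraceZ !mxE.
Qed.

(** * The inverse of [Jbeta] and the Cramer-Rao inequality *)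

Section CramerRao.
Variables (D F : 'I_2 -> 'M[R[i]]_d) (N : 'M[R[i]]_2).
Hypothesis LamF : forall k, Lam rho b (F k) = \sum_j N j k *: D j.
Hypothesis dualF : forall i k, \tr (D i *m F k) = (i == k)%:R.

(** Injectivity of [Lam] identifies [F k] with the combination of the [Lbeta] with coefficients
    [N j k]; duality then reads [J N = 1]. *)
Lemma invmx_Jbeta : invmx (Jbeta rho D b) = N.
Proof.
have JN : Jbeta rho D b *m N = 1%:M.
  apply/matrixP => i k; rewrite !mxE -dualF.
  have -> : F k = \sum_j N j k *: Lbeta rho D b j.
    apply: Lam_inj; rewrite LamF Lam_sum.
    by apply: eq_bigr => j _; rewrite Lam_Lbeta.
  rewrite mulmx_sumr mxtrace_sum; apply: eq_bigr => j _.
  by rewrite mxE -scalemxAr mxtraceZ mulrC.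
have [uJ _] := mulmx1_unit JN.
by rewrite -[RHS]mul1mx -(mulVmx uJ) -mulmxA JN mulmx1.
Qed.

Hypothesis hD : forall i, is_herm (D i).

Lemma Lam_form_dual X (x : 'I_2) k : (forall l, \tr (hadj X *m D l) = (l == x)%:R) ->
  Lam_form rho b X (F k) = N x k.
Proof.
move=> dualX; rewrite /Lam_form LamF mulmx_sumr mxtrace_sum (bigD1 x)//= big1.
  by rewrite -scalemxAr mxtraceZ dualX eqxx mulr1 addr0.
by move=> l /negPf lx; rewrite -scalemxAr mxtraceZ dualX lx mulr0.
Qed.

Lemma Lam_form_dualF j k : Lam_form rho b (F j) (F k) = N j k.
Proof.
apply: Lam_form_dual => l.
by rewrite -[D l]hD -hadjM mxtrace_hadj dualF conjC_nat.
Qed.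

Lemma dual_gram_herm : is_herm N.
Proof.
by apply/matrixP => j k; rewrite !mxE -!Lam_form_dualF Lam_form_conj.
Qed.

(** For Hermitian [B] it turns [Zmat rho B] into the Gram matrix of [B] for [Lam_form rho b]. *)
Definition scale_im (W : 'M[R[i]]_2) : 'M[R[i]]_2 :=
  \matrix_(j, k) Complex (complex.Re (W j k)) (b * complex.Im (W j k)).

(** The two traces of the form are complex conjugates, so the weights [(1 + b) / 2] and
    [(1 - b) / 2] keep the real part and multiply the imaginary part by [b]. *)
Lemma Lam_form_herm (X Y : 'M[R[i]]_d) : is_herm X -> is_herm Y ->
  Lam_form rho b X Y = Complex (complex.Re (\tr (rho *m Y *m X)))
                               (b * complex.Im (\tr (rho *m Y *m X))).
Proof.
move=> hX hY; rewrite Lam_formE hX.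
have -> : \tr (X *m Y *m rho) = Num.conj (\tr (rho *m Y *m X)).
  by rewrite -mxtrace_hadj !hadjM hX hY rho_pos.1 mulmxA.
rewrite -mulmxA mxtrace_mulC.
case: (\tr _) => x y; apply/eqP; rewrite eq_complex /=.
by apply/andP; split; apply/eqP; field.
Qed.

(** Duality makes the products of [B j] with [F k], of [F j] with [B k] and of [F j] with [F k] all
    equal to [N j k], so the Gram matrix of the differences collapses to one subtraction of [N]. *)
Lemma cramer_rao B : holevo_feasible D B ->
  psd (scale_im (Zmat rho B) - N).
Proof.
move=> [hB dualB].
rewrite (_ : _ - _ = \matrix_(j < 2, k < 2) Lam_form rho b (B j - F j) (B k - F k)).
  exact: gram_psd.
have BF j k : Lam_form rho b (B j) (F k) = N j k.
  by apply: Lam_form_dual => l; rewrite hB mxtrace_mulC dualB.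
apply/matrixP => j k; rewrite !mxE -Lam_form_herm//.
have -> : Lam_form rho b (B j - F j) (B k - F k) =
   Lam_form rho b (B j) (B k) - Lam_form rho b (B j) (F k)
   - Lam_form rho b (F j) (B k) + Lam_form rho b (F j) (F k).
  by rewrite /Lam_form LamB hadjB mxtrace_mulBB.
rewrite -(Lam_form_conj (B k) (F j)) !BF Lam_form_dualF.
rewrite -(Lam_form_dualF k j) Lam_form_conj Lam_form_dualF; ring.
Qed.

End CramerRao.
End LogarithmicDerivative.

(** * Real spans and coefficient matrices *)

Section RealSpan.
Variables (R : realType) (d : nat).
Implicit Types X Y : 'M[R[i]]_d.

Lemma in_rspan_coef m n (T : 'I_n -> 'M[R[i]]_d) (V : 'I_m -> 'M[R[i]]_d) :
  (forall j, in_rspan T (V j)) ->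
  exists a : 'M[R]_(m, n), forall j, V j = \sum_k rC (a j k) *: T k.
Proof.
move=> /choice[a aE]; exists (\matrix_(j, k) a j k) => j.
by rewrite aE; apply: eq_bigr => k _; rewrite mxE.
Qed.

Lemma rspan_mulmx m n (T : 'I_n -> 'M[R[i]]_d) (V : 'I_m -> 'M[R[i]]_d)
    (a : 'M[R]_(m, n)) (v : 'rV[R]_m) :
  (forall j, V j = \sum_k rC (a j k) *: T k) ->
  \sum_j rC (v 0 j) *: V j = \sum_k rC ((v *m a) 0 k) *: T k.
Proof.
move=> aE; under eq_bigr do rewrite aE scaler_sumr.
rewrite exchange_big; apply: eq_bigr => k _ /=.
rewrite mxE rCE rmorph_sum scaler_suml; apply: eq_bigr => j _.
by rewrite scalerA rmorphM.
Qed.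

Lemma in_rspan_sum m n (T : 'I_n -> 'M[R[i]]_d) (V : 'I_m -> 'M[R[i]]_d)
    (c : 'I_m -> R) :
  (forall j, in_rspan T (V j)) -> in_rspan T (\sum_j rC (c j) *: V j).
Proof.
move=> /in_rspan_coef[a aE]; exists (fun k => ((\row_j c j) *m a) 0 k).
by rewrite -(rspan_mulmx _ aE); apply: eq_bigr => j _; rewrite mxE.
Qed.

Lemma in_rspan_basis n (T : 'I_n -> 'M[R[i]]_d) k : in_rspan T (T k).
Proof.
exists (fun l => (l == k)%:R); rewrite (bigD1 k)//= eqxx rCE rmorph1 scale1r.
by rewrite big1 ?addr0// => l /negPf ->; rewrite rCE rmorph0 scale0r.
Qed.

End RealSpan.

(** * The SLD inner product and the commutation operator *)

Section SymmetricPairing.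
Variables (R : realType) (d : nat) (rho : 'M[R[i]]_d).
Hypothesis rho_pos : posdef rho.
Implicit Types X Y : 'M[R[i]]_d.

Definition pairing X Y : R[i] := \tr (Lam rho 0 X *m Y).

Lemma pairing_suml n (a : 'I_n -> R[i]) (V : 'I_n -> 'M[R[i]]_d) Y :
  pairing (\sum_k a k *: V k) Y = \sum_k a k * pairing (V k) Y.
Proof.
rewrite /pairing Lam_sum mulmx_suml mxtrace_sum; apply: eq_bigr => k _.
by rewrite -scalemxAl mxtraceZ.
Qed.

Lemma pairingC X Y : pairing X Y = pairing Y X.
Proof.
rewrite /pairing /Lam addr0 subr0 !mulmxDl -!scalemxAl !mxtraceD !mxtraceZ.
rewrite -!mulmxA addrC; congr (_ * _ + _ * _).
  by rewrite mxtrace_mulC mulmxA.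
by rewrite [RHS]mxtrace_mulC mulmxA.
Qed.

Lemma pairing_sumr n (a : 'I_n -> R[i]) (V : 'I_n -> 'M[R[i]]_d) Y :
  pairing Y (\sum_k a k *: V k) = \sum_k a k * pairing Y (V k).
Proof.
by rewrite pairingC pairing_suml; apply: eq_bigr => k _; rewrite pairingC.
Qed.

Lemma pairing_herm X Y : is_herm X -> is_herm Y ->
  pairing X Y = rC (complex.Re (\tr (rho *m X *m Y))).
Proof.
move=> hX hY; have := Lam_form_herm 0 rho_pos hY hX.
by rewrite /Lam_form hY mxtrace_mulC mul0r.
Qed.

Lemma pairing_gt0 X : is_herm X -> X != 0 -> 0 < pairing X X.
Proof.
move=> hX X0; have := @Lam_form_gt0 _ _ _ 0 rho_pos _ X X0.
by rewrite /Lam_form hX mxtrace_mulC; apply; rewrite lexx ler01.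
Qed.

(** A left kernel vector gives a combination of the [V k] of zero SLD norm, hence zero. *)
Lemma gram_unit n (V : 'I_n -> 'M[R[i]]_d) : (forall k, is_herm (V k)) ->
  rlin_indep V ->
  \matrix_(j < n, k < n) complex.Re (\tr (rho *m V j *m V k)) \in unitmx.
Proof.
move=> hV indV; set g := \matrix_(j, k) _.
rewrite -row_free_unit; apply: inj_row_free => v vg.
set X := \sum_j rC (v 0 j) *: V j.
have hX : is_herm X.
  by apply: (herm_rspan hV); apply: in_rspan_sum => j; exact: in_rspan_basis.
have [/indV v0|/(pairing_gt0 hX)] := eqVneq X 0.
  by apply/rowP => j; rewrite v0 mxE.
rewrite {2}/X pairing_sumr big1 ?ltxx// => k _.
rewrite /X pairing_suml (_ : \sum_j _ = rC ((v *m g) 0 k)).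
  by rewrite vg mxE mulr0.
rewrite mxE rCE rmorph_sum; apply: eq_bigr => j _.
by rewrite pairing_herm// rmorphM mxE.
Qed.

(** Pairing with the [U j] recovers the coefficients of a combination of the [V j]. So the square
    coefficient matrix of [V] in [T] is invertible, and the [V j] generate the span of [T]. *)
Lemma dual_expansion n (T V U : 'I_n -> 'M[R[i]]_d) X :
  (forall j, in_rspan T (V j)) -> in_rspan T X ->
  (forall i j, pairing (V i) (U j) = (i == j)%:R) ->
  X = \sum_j pairing X (U j) *: V j.
Proof.
move=> /in_rspan_coef[a aE] [c XE] dualVU.
have pairV (v : 'I_n -> R) j : pairing (\sum_i rC (v i) *: V i) (U j) = rC (v j).
  rewrite pairing_suml (bigD1 j)//= dualVU eqxx mulr1 big1 ?addr0// => i /negPf ij.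
  by rewrite dualVU ij mulr0.
have ua : a \in unitmx.
  rewrite -row_free_unit; apply: inj_row_free => v va.
  apply/rowP => j; rewrite mxE; apply: (@complexI R).
  change (rC (v 0 j) = 0); rewrite -(pairV (v 0)) (rspan_mulmx _ aE) va.
  rewrite big1; first by rewrite /pairing Lam0 mul0mx mxtrace0.
  by move=> k _; rewrite mxE rCE rmorph0 scale0r.
set w := (\row_k c k) *m invmx a.
have -> : X = \sum_j rC (w 0 j) *: V j.
  rewrite (rspan_mulmx _ aE) /w -mulmxA mulVmx// mulmx1 XE.
  by apply: eq_bigr => k _; rewrite mxE.
by apply: eq_bigr => j _; rewrite pairV.
Qed.

(** The anticommutator with [rho] is twice [Lam rho 0], which is surjective, so the equation
    defining [Dcomm] is solvable. *)
Lemma Lam0_Dcomm X : Lam rho 0 (Dcomm rho X) =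
  (iC R / 2) *: (X *m rho - rho *m X).
Proof.
have [Y YE] := @Lam_surj _ _ _ 0 rho_pos (ltac:(by rewrite lexx ler01))
  ((iC R / 2) *: (X *m rho - rho *m X)).
have twoLam Z : Z *m rho + rho *m Z = 2 *: Lam rho 0 Z.
  rewrite /Lam addr0 subr0 scalerDr !scalerA.
  have -> : 2 * rC (1 / 2) = 1 :> R[i].
    by rewrite rCE rmorphM rmorph1 mul1r fmorphV rmorph_nat divff// pnatr_eq0.
  by rewrite !scale1r addrC.
have two_neq0 : 2 != 0 :> R[i] by rewrite pnatr_eq0.
have : Dcomm rho X *m rho + rho *m Dcomm rho X = iC R *: (X *m rho - rho *m X).
  apply: (@xgetPex _ _ [set Y | Y *m rho + rho *m Y = iC R *: (X *m rho - rho *m X)]).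
  by exists Y => /=; rewrite twoLam YE scalerA mulrCA divff ?mulr1.
rewrite twoLam => e.
by rewrite -[LHS](scalerK two_neq0) e scalerA mulrC.
Qed.

(** Counterpart of [pairing_herm]: expanding [X] and [Dcomm rho X] in a dual basis produces the real
    and the imaginary parts of the same traces. *)
Lemma pairing_Dcomm X Y : is_herm X -> is_herm Y ->
  pairing (Dcomm rho X) Y = rC (complex.Im (\tr (rho *m X *m Y))).
Proof.
move=> hX hY; rewrite /pairing Lam0_Dcomm -scalemxAl mxtraceZ mulmxBl mxtraceB.
have -> : \tr (X *m rho *m Y) = Num.conj (\tr (rho *m X *m Y)).
  by rewrite -mxtrace_hadj !hadjM hX hY rho_pos.1 mxtrace_mulC.
rewrite -opprB [X in - X]subcJ -!rCE -/(iC R); set r := rC _.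
have -> : iC R / 2 * - (2 * r * iC R) = - (iC R * iC R) * r by field.
by rewrite sqr_iC opprK mul1r.
Qed.

(** The part of [Lam] proportional to [b] is half a commutator with [rho], which [Lam0_Dcomm]
    expresses through [Dcomm]. *)
Lemma Lam_Dcomm b X :
  Lam rho b X = Lam rho 0 X + (iC R * rC b) *: Lam rho 0 (Dcomm rho X).
Proof.
rewrite Lam0_Dcomm scalerA.
have -> : iC R * rC b * (iC R / 2) = - rC (b / 2).
  rewrite mulrACA sqr_iC mulN1r; congr (- _).
  by rewrite !rCE (rmorphM (real_complex R)) fmorphV (rmorph_nat (real_complex R)).
rewrite /Lam addr0 subr0 scaleNr scalerBr opprB.
have -> : rC ((1 + b) / 2) = rC (1 / 2) + rC (b / 2).
  by rewrite mulrDl !rCE (rmorphD (real_complex R)).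
have -> : rC ((1 - b) / 2) = rC (1 / 2) - rC (b / 2).
  by rewrite mulrBl !rCE (rmorphB (real_complex R)).
move: (rC (1 / 2)) (rC (b / 2)) (rho *m X) (X *m rho) => x y P Q.
by rewrite (scalerDl P x y) (scalerBl x y Q) addrACA [in RHS]addrC [RHS]addrC.
Qed.

End SymmetricPairing.

(** * The Holevo functional and its monotonicity *)

(** Common form of [Cbeta] and [holevo_obj], taken at [invmx (Jbeta rho D b)] and at
    [Zmat rho B]. *)
Definition holevo_fun (R : realType) (G : 'M[R]_2) (W : 'M[R[i]]_2) : R :=
  complex.Re (\tr (RtoC G *m W)) + trnorm (msqrt G *m Defs.ImM W *m msqrt G).

Section HolevoFunctional.
Variables (R : realType) (G : 'M[R]_2).
Hypothesis G_pos : rposdef G.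
Implicit Types W : 'M[R[i]]_2.
Local Notation Re := (@complex.Re R).
Local Notation Im := (@complex.Im R).

Lemma herm2E W : is_herm W -> [/\ Im (W 0 0) = 0, Im (W 1 1) = 0,
  Re (W 1 0) = Re (W 0 1) & Im (W 1 0) = - Im (W 0 1)].
Proof.
move=> /matrixP hW; move: (hW 0 0) (hW 1 1) (hW 1 0); rewrite !mxE.
case: (W 0 0) => a a'; case: (W 1 1) => b b'.
case: (W 0 1) => c c'; case: (W 1 0) => e e' [h1] [h2] [h3 h4] /=.
by split=> //; lra.
Qed.

Lemma herm_ImM_skew W : is_herm W -> (Defs.ImM W)^T = - Defs.ImM W.
Proof.
case/herm2E => w00 w11 _ w10.
by apply: mx2P; rewrite !mxE ?w00 ?w11 ?w10 ?oppr0 ?opprK.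
Qed.

Lemma Re_mxtrace_RtoC (A : 'M[R]_2) W : Re (\tr (RtoC A *m W)) =
  A 0 0 * Re (W 0 0) + A 0 1 * Re (W 1 0)
  + (A 1 0 * Re (W 0 1) + A 1 1 * Re (W 1 1)).
Proof.
rewrite /mxtrace sum_ord2 !mxE2 !mxE.
by case: (W 0 0) (W 0 1) (W 1 0) (W 1 1) => ? ? [? ?] [? ?] [? ?] /=; ring.
Qed.

Lemma holevo_funE W : is_herm W -> holevo_fun G W =
  G 0 0 * Re (W 0 0) + G 1 1 * Re (W 1 1) + 2 * G 0 1 * Re (W 0 1)
  + 2 * Num.sqrt (det2 G) * `|Im (W 0 1)|.
Proof.
move=> hW; rewrite /holevo_fun Re_mxtrace_RtoC trnorm_skew ?herm_ImM_skew//.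
have [_ _ -> _] := herm2E hW; have [-> _ _ _] := rposdef2 G_pos.
by rewrite mxE; ring.
Qed.

(* [v] is chosen so that [v v^*] is proportional to the rank-one matrix
   [G + i s J], where [J = [[0, -1], [1, 0]]]. *)
Lemma psd_Im_le W (s : R) : psd W -> s ^+ 2 = det2 G ->
  2 * s * Im (W 0 1) <=
  G 0 0 * Re (W 0 0) + G 1 1 * Re (W 1 1) + 2 * G 0 1 * Re (W 0 1).
Proof.
move=> [hW psdW] sE; have [_ _ w10 w10'] := herm2E hW.
have [sG G00 _ _] := rposdef2 G_pos; rewrite /det2 sG in sE.
have := psdW (\col_i (if i == 0 then rC (G 0 0) else Complex (G 0 1) s)).
rewrite !mxE sum_ord2 !mxE !sum_ord2 !mxE /= lecE => /andP[_].
move: w10 w10'; case: (W 0 0) (W 0 1) (W 1 0) (W 1 1)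
  => [a a'] [c c'] [e e'] [f f'] /= -> -> h.
rewrite -(ler_pM2l G00) -subr_ge0.
apply: le_trans h _; rewrite le_eqVlt; apply/orP; left; apply/eqP.
have -> : G 0 0 * (G 0 0 * a + G 1 1 * f + 2 * G 0 1 * c) - G 0 0 * (2 * s * c') =
  G 0 0 ^+ 2 * a + (s ^+ 2 + G 0 1 * G 0 1) * f + 2 * G 0 0 * G 0 1 * c
  - 2 * G 0 0 * s * c' by rewrite sE; ring.
ring.
Qed.

(** Applied to [W2 - W1] with both roots of [det2 G], [psd_Im_le] shows that the real part grows at
    least as much as the trace norm can drop. *)
Lemma holevo_fun_le W1 W2 : is_herm W1 -> is_herm W2 -> psd (W2 - W1) ->
  holevo_fun G W1 <= holevo_fun G W2.
Proof.
move=> h1 h2 psdW; rewrite !holevo_funE//.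
have [_ _ _ dG] := rposdef2 G_pos.
set g := Num.sqrt _.
have g0 : 0 <= g by exact: sqrtr_ge0.
have gE : g ^+ 2 = det2 G by rewrite sqr_sqrtr// ltW.
have := psd_Im_le psdW gE.
have := psd_Im_le (s := - g) psdW; rewrite sqrrN => /(_ gE).
rewrite !mxE; case: (W1 0 0) (W1 0 1) (W1 1 1) => [a a'] [c c'] [e e'] /=.
case: (W2 0 0) (W2 0 1) (W2 1 1) => [x x'] [y y'] [z z'] /= m1 m2.
(* The sign of the imaginary entry of [W1] removes its absolute value and leaves a linear goal. *)
have [s [s1 sc]] : exists s : R, (s = 1 \/ s = -1) /\ `|c'| = s * c'.
  have [c0|c0] := leP 0 c'; first by exists 1; split; [left|rewrite ger0_norm ?mul1r].
  by exists (-1); split; [right|rewrite ltr0_norm ?mulN1r].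
have : g * (s * y') <= g * `|y'|.
  apply: ler_wpM2l => //; rewrite (le_trans (ler_norm _))// normrM.
  by case: s1 => ->; rewrite ?normrN normr1 mul1r.
by rewrite sc; case: s1 => -> yy; lra.
Qed.

Lemma scale_im_herm b W : is_herm W -> is_herm (scale_im b W).
Proof.
move=> /matrixP hW; apply/matrixP => i j; move: (hW i j); rewrite !mxE => <-.
by case: (W j i) => x y; apply/eqP; rewrite eq_complex/= mulrN !eqxx.
Qed.

Lemma holevo_fun_scale_im (b : R) W : 0 <= b <= 1 -> is_herm W ->
  holevo_fun G (scale_im b W) <= holevo_fun G W.
Proof.
move=> /andP[b0 b1] hW; rewrite !holevo_funE//; last exact: scale_im_herm.
rewrite !mxE /= lerD2l ler_wpM2l ?mulr_ge0 ?sqrtr_ge0// normrM ger0_norm//.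
by rewrite ler_piMl.
Qed.

End HolevoFunctional.

(** * The frame adapted to the invariant space *)

Lemma addr_scale_lincomb (K : pzRingType) (V : lmodType K) n (x y : 'I_n -> K)
    (x' y' z : K) (v : 'I_n -> V) (w : V) :
  (\sum_j x j *: v j + x' *: w) + z *: (\sum_j y j *: v j + y' *: w) =
  \sum_j (x j + z * y j) *: v j + (x' + z * y') *: w.
Proof.
rewrite scalerDr scaler_sumr addrACA -big_split/= scalerA -scalerDl.
by congr (_ + _); apply: eq_bigr => j _; rewrite scalerA -scalerDl.
Qed.

Section AdaptedFrame.
Variables (R : realType) (d : nat) (rho : 'M[R[i]]_d) (D : 'I_2 -> 'M[R[i]]_d).
Hypothesis rho_pos : posdef rho.
Local Notation L := (Lbeta rho D 0).
Variable T : 'I_3 -> 'M[R[i]]_d.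
Hypotheses (hT : forall k, is_herm (T k)) (indT : rlin_indep T).
Hypothesis indL : rlin_indep L.
Hypothesis LT : forall i, in_rspan T (L i).
Hypothesis DT : forall X, in_rspan T X -> in_rspan T (Dcomm rho X).

Let Lam0_L i : Lam rho 0 (L i) = D i.
Proof. by apply: Lam_Lbeta => //; rewrite lexx ler01. Qed.

Lemma exists_dual_SLD : exists K : 'M[R]_2, forall i k,
  \tr (D i *m \sum_j rC (K j k) *: L j) = (i == k)%:R.
Proof.
have hL i : is_herm (L i) by exact: (herm_rspan hT).
have := gram_unit rho_pos hL indL; set g := \matrix_(i, j) _ => ug.
exists (invmx g) => i k; rewrite -Lam0_L -/(pairing rho _ _) pairing_sumr.
transitivity (rC ((g *m invmx g) i k)); last by rewrite mulmxV// mxE rCE rmorph_nat.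
rewrite mxE rCE rmorph_sum; apply: eq_bigr => j _.
by rewrite pairing_herm// rmorphM mxE mulrC.
Qed.

(** Orthogonality to the two SLDs imposes two real equations on three coordinates; a nonzero
    solution is then normalised. *)
Lemma exists_orthonormal_SLD : exists E3, [/\ in_rspan T E3,
  forall i, \tr (D i *m E3) = 0 & pairing rho E3 E3 = 1].
Proof.
pose M : 'M[R]_(3, 2) := \matrix_(k, i) complex.Re (\tr (rho *m L i *m T k)).
have hL i : is_herm (L i) by exact: (herm_rspan hT).
have : kermx M != 0.
  by rewrite -mxrank_eq0 mxrank_ker subn_eq0 -ltnNge (leq_ltn_trans (rank_leq_col M)).
case/rowV0Pn => v /sub_kermxP vM v0.
pose X := \sum_k rC (v 0 k) *: T k.
have XT : in_rspan T X by exists (v 0).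
have hX := herm_rspan hT XT.
have X0 : X != 0.
  by apply: contra v0 => /eqP/indT vk; apply/eqP/rowP => k; rewrite vk mxE.
have DX i : \tr (D i *m X) = 0.
  rewrite -Lam0_L -/(pairing rho _ _) pairing_sumr.
  transitivity (rC ((v *m M) 0 i)); last by rewrite vM mxE.
  rewrite mxE rCE rmorph_sum; apply: eq_bigr => k _.
  by rewrite pairing_herm// rmorphM mxE.
have := pairing_gt0 rho_pos hX X0; rewrite pairing_herm//.
set x := complex.Re _; rewrite rCE ltcR => x0.
pose y := (Num.sqrt x)^-1.
have pZ A B : pairing rho (rC y *: A) (rC y *: B) = rC (y ^+ 2) * pairing rho A B.
  rewrite /pairing -scalemxAr mxtraceZ LamZ -scalemxAl mxtraceZ mulrA.
  by rewrite [rC (y ^+ 2)]rCE (rmorphXn (real_complex R)) expr2.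
exists (rC y *: X); split.
- by case: XT => c ->; rewrite scaler_sumr; exists (fun k => y * c k);
    apply: eq_bigr => k _; rewrite scalerA !rCE (rmorphM (real_complex R)).
- by move=> i; rewrite -scalemxAr mxtraceZ DX mulr0.
- rewrite pZ pairing_herm// !rCE -(rmorphM (real_complex R)) /y exprVn.
  by rewrite sqr_sqrtr ?ltW// mulVf ?gt_eqF// rmorph1.
Qed.

(** Invariance keeps [Dcomm rho X] in the span, so [Lam rho b X] expands in [D 0], [D 1] and
    [Lam rho 0 E3] for every [b], with explicit coefficients. *)
Lemma adapted_frame : exists (E : 'I_2 -> 'M[R[i]]_d) (E3 : 'M[R[i]]_d),
  [/\ (forall k, is_herm (E k)) /\ is_herm E3,
      forall i k, \tr (D i *m E k) = (i == k)%:R,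
      forall i, \tr (D i *m E3) = 0,
      pairing rho E3 E3 = 1 /\ (forall k, pairing rho E3 (E k) = 0) &
      forall b X, X = E3 \/ (exists k, X = E k) -> Lam rho b X =
        \sum_j Complex (complex.Re (\tr (rho *m X *m E j)))
                       (b * complex.Im (\tr (rho *m X *m E j))) *: D j
        + Complex (complex.Re (\tr (rho *m X *m E3)))
                  (b * complex.Im (\tr (rho *m X *m E3))) *: Lam rho 0 E3].
Proof.
have [K dualK] := exists_dual_SLD.
have [E3 [E3T DE3 E33]] := exists_orthonormal_SLD.
pose E k := \sum_j rC (K j k) *: L j.
have ET k : in_rspan T (E k) by exact: in_rspan_sum.
have E3E k : pairing rho E3 (E k) = 0.
  rewrite pairing_sumr big1// => j _.
  by rewrite pairingC /pairing Lam0_L DE3 mulr0.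
exists E, E3; split; [|exact: dualK|exact: DE3|by split; [exact: E33|exact: E3E]|].
  by split; [move=> k; exact: (herm_rspan hT)|exact: (herm_rspan hT)].
(* Two bases dual for the SLD pairing; [Lam rho 0] sends the first to [D 0], [D 1] and
   [Lam rho 0 E3]. *)
pose V (i : 'I_3) := nth E3 [:: L 0; L 1; E3] i.
pose U (i : 'I_3) := nth E3 [:: E 0; E 1; E3] i.
have pLE i k : pairing rho (L i) (E k) = (i == k)%:R by rewrite /pairing Lam0_L dualK.
have pLE3 i : pairing rho (L i) E3 = 0 by rewrite /pairing Lam0_L DE3.
have VT i : in_rspan T (V i) by case: i => [[|[|[|//]]] ?]; rewrite /V/=.
have dualVU i j : pairing rho (V i) (U j) = (i == j)%:R.
  case: i j => [[|[|[|//]]] ?] [[|[|[|//]]] ?];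
  by rewrite /V /U /= ?pLE ?pLE3 ?E33 ?E3E.
have expand X : in_rspan T X -> Lam rho 0 X =
    \sum_j pairing rho X (E j) *: D j + pairing rho X E3 *: Lam rho 0 E3.
  move=> XT; rewrite {1}(dual_expansion VT XT dualVU) Lam_sum.
  rewrite sum_ord2 !big_ord_recl big_ord0 addr0 addrA -!Lam0_L.
  by congr (_ *: Lam _ _ _ + _ *: Lam _ _ _ + _).
move=> b X XE.
have XT : in_rspan T X by case: XE => [->|[k ->]].
have hX := herm_rspan hT XT.
rewrite (Lam_Dcomm rho_pos) (expand _ XT) (expand _ (DT XT)).
rewrite addr_scale_lincomb.
have coef Y : in_rspan T Y -> Complex (complex.Re (\tr (rho *m X *m Y)))
    (b * complex.Im (\tr (rho *m X *m Y))) =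
    pairing rho X Y + iC R * rC b * pairing rho (Dcomm rho X) Y.
  move=> /(herm_rspan hT) hY; rewrite pairing_herm// pairing_Dcomm// Complex_rC.
  by rewrite [rC (b * _)]rCE (rmorphM (real_complex R)) mulrA.
by rewrite coef//; congr (_ + _); apply: eq_bigr => j _; rewrite coef.
Qed.

End AdaptedFrame.

(** * Explicit formulas in the frame *)

Lemma mxtrace_mulDD (K : comPzRingType) n (P A B U : 'M[K]_n) (a b : K) :
  \tr (P *m (A + a *: U) *m (B + b *: U)) =
  \tr (P *m A *m B) + b * \tr (P *m A *m U)
  + a * \tr (P *m U *m B) + a * b * \tr (P *m U *m U).
Proof.
rewrite !mulmxDr !mulmxDl -!scalemxAr -!scalemxAl !mxtraceD !mxtraceZ.
by rewrite addrACA !addrA mulrA [b * a]mulrC.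
Qed.

Lemma mxtrace_herm_swap (R : realType) d (rho X Y : 'M[R[i]]_d) :
  is_herm rho -> is_herm X -> is_herm Y ->
  \tr (rho *m X *m Y) = Num.conj (\tr (rho *m Y *m X)).
Proof.
move=> hr hX hY; rewrite -mxtrace_hadj !hadjM hr hX hY mulmxA.
by rewrite -mulmxA mxtrace_mulC.
Qed.

Lemma Zmat_herm (R : realType) d (rho : 'M[R[i]]_d) (B : 'I_2 -> 'M[R[i]]_d) :
  is_herm rho -> (forall k, is_herm (B k)) -> is_herm (Zmat rho B).
Proof.
move=> hr hB; apply/matrixP => i j; rewrite !mxE.
by rewrite [in RHS]mxtrace_herm_swap.
Qed.

Lemma herm_Lam0 (R : realType) d (rho X : 'M[R[i]]_d) :
  is_herm rho -> is_herm X -> is_herm (Lam rho 0 X).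
Proof.
move=> hr hX; rewrite /is_herm hadjD !hadjZ !conj_rC !hadjM hr hX.
by rewrite addrC /Lam addr0 subr0.
Qed.

Lemma betahatE (R : realType) d G (rho : 'M[R[i]]_d) D J0 J1 :
  invmx (Jbeta rho D 0) = J0 -> invmx (Jbeta rho D 1) = J1 ->
  betahat G rho D = trnorm (msqrt G *m Defs.ImM J1 *m msqrt G) /
    (2 * complex.Re (\tr (RtoC G *m (J0 - RtoC (Defs.ReM J1))))).
Proof. by move=> <- <-. Qed.

Lemma betahat_finiteE (R : realType) d (rho : 'M[R[i]]_d) D J0 J1 :
  invmx (Jbeta rho D 0) = J0 -> invmx (Jbeta rho D 1) = J1 ->
  betahat_finite rho D = (J0 != RtoC (Defs.ReM J1)).
Proof. by move=> <- <-. Qed.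

Section Frame.
Variables (R : realType) (d : nat) (rho : 'M[R[i]]_d) (D : 'I_2 -> 'M[R[i]]_d).
Hypothesis rho_pos : posdef rho.
Hypothesis hD : forall i, is_herm (D i).
Variables (E : 'I_2 -> 'M[R[i]]_d) (E3 : 'M[R[i]]_d).
Hypotheses (hE : forall k, is_herm (E k)) (hE3 : is_herm E3).
Hypothesis dualE : forall i k, \tr (D i *m E k) = (i == k)%:R.
Hypothesis DE3 : forall i, \tr (D i *m E3) = 0.
Hypothesis E33 : pairing rho E3 E3 = 1.
Hypothesis E3E : forall k, pairing rho E3 (E k) = 0.
Hypothesis LamE : forall b X, X = E3 \/ (exists k, X = E k) -> Lam rho b X =
  \sum_j Complex (complex.Re (\tr (rho *m X *m E j)))
                 (b * complex.Im (\tr (rho *m X *m E j))) *: D j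
  + Complex (complex.Re (\tr (rho *m X *m E3)))
            (b * complex.Im (\tr (rho *m X *m E3))) *: Lam rho 0 E3.
Local Notation Re := (@complex.Re R).
Local Notation Im := (@complex.Im R).

Definition frame_q k : R := Im (\tr (rho *m E3 *m E k)).
Local Notation q := frame_q.
Local Notation W := (Zmat rho E).

Let trE3E k : \tr (rho *m E3 *m E k) = Complex 0 (q k).
Proof.
have := E3E k; rewrite pairing_herm// /q.
by case: (\tr _) => x y [/= ->].
Qed.

Let trEE3 k : \tr (rho *m E k *m E3) = Complex 0 (- q k).
Proof. by rewrite (mxtrace_herm_swap rho_pos.1)// trE3E. Qed.

Let trE3E3 : \tr (rho *m E3 *m E3) = 1.
Proof.
have := E33; rewrite pairing_herm//.
have := mxtrace_herm_swap rho_pos.1 hE3 hE3.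
case: (\tr _) => x y [/= yE] [xE]; apply/eqP; rewrite eq_complex/= xE eqxx/=.
by apply/eqP; lra.
Qed.

Definition frame_inv b : 'M[R[i]]_2 := \matrix_(j, k)
  Complex (Re (W j k) - b ^+ 2 * (q j * q k)) (b * Im (W j k)).

Let F b k := E k + (iC R * rC (b * q k)) *: E3.

Let LamF b k : Lam rho b (F b k) = \sum_j frame_inv b j k *: D j.
Proof.
rewrite LamD LamZ [Lam rho b (E k)]LamE; last by right; exists k.
rewrite [Lam rho b E3]LamE; last by left.
rewrite addr_scale_lincomb trEE3 trE3E3.
(* The multiple of [E3] in [F] is chosen for this: [E k] contributes [- i b q_k] along
   [Lam rho 0 E3], and the correction contributes [+ i b q_k]. *)
rewrite [X in _ + X *: _](_ : _ = 0) ?scale0r ?addr0.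
  apply: eq_bigr => j _; congr (_ *: _); rewrite trE3E [RHS]mxE !mxE.
  by apply/eqP; rewrite eq_complex/=; apply/andP; split; apply/eqP; ring.
by apply/eqP; rewrite eq_complex/=; apply/andP; split; apply/eqP; ring.
Qed.

Let dualF b i k : \tr (D i *m F b k) = (i == k)%:R.
Proof. by rewrite mulmxDr -scalemxAr mxtraceD mxtraceZ DE3 mulr0 addr0. Qed.

Lemma invmx_Jbeta_frame b : 0 <= b <= 1 -> invmx (Jbeta rho D b) = frame_inv b.
Proof. by move=> b01; apply: (invmx_Jbeta rho_pos b01 (LamF b) (dualF b)). Qed.

Lemma frame_inv_herm b : is_herm (frame_inv b).
Proof. exact: (dual_gram_herm rho_pos (LamF b) (dualF b) hD). Qed.

Variable G : 'M[R]_2.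
Hypothesis G_pos : rposdef G.

(** Two decreasing steps from [Zmat rho B]: shrinking its imaginary part by [b <= 1], then passing
    to [frame_inv b] by [cramer_rao] and monotonicity. *)
Lemma Cbeta_le_holevo_obj b B : 0 <= b <= 1 -> holevo_feasible D B ->
  Cbeta G rho D b <= holevo_obj G rho B.
Proof.
move=> b01 feasB.
have hZ : is_herm (Zmat rho B) by apply: Zmat_herm feasB.1; exact: rho_pos.1.
have -> : Cbeta G rho D b = holevo_fun G (frame_inv b).
  by rewrite -invmx_Jbeta_frame.
apply: (@le_trans _ _ (holevo_fun G (scale_im b (Zmat rho B)))); last first.
  exact: holevo_fun_scale_im.
apply: holevo_fun_le => //; [exact: frame_inv_herm|exact: scale_im_herm|].
exact: (cramer_rao rho_pos b01 (LamF b) (dualF b) hD feasB).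
Qed.

Let g := Num.sqrt (det2 G).
Definition frame_quad := G 0 0 * q 0 ^+ 2 + 2 * G 0 1 * (q 0 * q 1) + G 1 1 * q 1 ^+ 2.
Definition frame_skew := g * `|Im (W 0 1)|.
Definition frame_base :=
  G 0 0 * Re (W 0 0) + G 1 1 * Re (W 1 1) + 2 * G 0 1 * Re (W 0 1).
Local Notation a := frame_quad.
Local Notation h := frame_skew.
Local Notation kappa := frame_base.

Lemma Cbeta_frame b : 0 <= b <= 1 ->
  Cbeta G rho D b = kappa - b ^+ 2 * a + 2 * (b * h).
Proof.
move=> b01; have -> : Cbeta G rho D b = holevo_fun G (frame_inv b).
  by rewrite -invmx_Jbeta_frame.
rewrite holevo_funE//; last exact: frame_inv_herm.
have -> : `|Im (frame_inv b 0 1)| = b * `|Im (W 0 1)|.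
  by rewrite mxE/= normrM ger0_norm//; case/andP: b01.
rewrite [frame_inv b 0 0]mxE [frame_inv b 0 1]mxE [frame_inv b 1 1]mxE /=.
by rewrite /a /h /kappa -/g; ring.
Qed.

(** SLD orthogonality makes the traces mixing [E3] and [E k] purely imaginary, so the shift adds
    [t t^T] to the real part of [Zmat] and a skew term in [t] and [q] to the imaginary part. *)
Lemma holevo_obj_frame (t : 'I_2 -> R) :
  holevo_obj G rho (fun k => E k + rC (t k) *: E3) = kappa
  + (G 0 0 * t 0 ^+ 2 + 2 * G 0 1 * (t 0 * t 1) + G 1 1 * t 1 ^+ 2)
  + 2 * g * `|Im (W 0 1) + t 1 * q 0 - t 0 * q 1|.
Proof.
set B := fun k => _.
have ZE j k : Zmat rho B j k = Complex (Re (W j k) + t j * t k)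
    (Im (W j k) + t k * q j - t j * q k).
  rewrite [LHS]mxE mxtrace_mulDD trEE3 trE3E trE3E3 [in RHS]mxE.
  case: (\tr _) => x y; apply/eqP; rewrite eq_complex/=.
  by apply/andP; split; apply/eqP; ring.
have -> : holevo_obj G rho B = holevo_fun G (Zmat rho B) by [].
rewrite holevo_funE//; last first.
  by apply: (Zmat_herm rho_pos.1) => k; apply: hermD; [|exact: hermZ].
by rewrite !ZE /= -/g /kappa; ring.
Qed.

Lemma frame_feasible (t : 'I_2 -> R) :
  holevo_feasible D (fun k => E k + rC (t k) *: E3).
Proof.
split=> [k|i k]; first by apply: hermD; [|exact: hermZ].
by rewrite mulmxDr -scalemxAr mxtraceD mxtraceZ DE3 mulr0 addr0.
Qed.

(* [t] minimises [t^T G t + 2 b s g (q_0 t_1 - q_1 t_0)], a lower bound of the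
   [t]-dependent part of the objective when [s] is the sign of [Im (W 0 1)]. *)
Lemma holevo_obj_attained b : b * a <= h ->
  exists B, holevo_feasible D B /\
    holevo_obj G rho B = kappa + b ^+ 2 * a + 2 * (h - b * a).
Proof.
move=> bah; have [sG _ _ dG] := rposdef2 G_pos.
have g0 : 0 < g by rewrite sqrtr_gt0.
have gE : g ^+ 2 = det2 G by rewrite sqr_sqrtr// ltW.
have [s [s1 sc]] : exists s : R, s * s = 1 /\ `|Im (W 0 1)| = s * Im (W 0 1).
  have [c0|c0] := leP 0 (Im (W 0 1)).
    by exists 1; rewrite mul1r ger0_norm ?mul1r.
  by exists (-1); rewrite mulrNN mul1r ltr0_norm ?mulN1r.
pose t (k : 'I_2) : R := if k == 0 then b * s / g * (G 0 1 * q 0 + G 1 1 * q 1)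
  else - (b * s / g * (G 0 0 * q 0 + G 0 1 * q 1)).
exists (fun k => E k + rC (t k) *: E3); split; first exact: frame_feasible.
rewrite holevo_obj_frame.
have g_neq0 : g != 0 by rewrite gt_eqF.
(* For this [t] the skew entry keeps the sign [s], because [b * a <= h]; its absolute value then
   opens. *)
have -> : Im (W 0 1) + t 1 * q 0 - t 0 * q 1 = s * ((h - b * a) / g).
  rewrite /h sc; have -> : s * ((g * (s * Im (W 0 1)) - b * a) / g) =
    (s * s) * Im (W 0 1) - s * b * a / g by field.
  by rewrite s1 mul1r /t/= /a; field.
have -> : `|s * ((h - b * a) / g)| = (h - b * a) / g.
  rewrite normrM [X in _ * X]ger0_norm ?divr_ge0 ?subr_ge0 ?(ltW g0)//.
  have -> : `|s| = 1; last by rewrite mul1r.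
  by rewrite -sqrtr_sqr expr2 s1 sqrtr1.
have -> : G 0 0 * t 0 ^+ 2 + 2 * G 0 1 * (t 0 * t 1) + G 1 1 * t 1 ^+ 2
    = b ^+ 2 * a.
  transitivity ((s * s) * b ^+ 2 * a * (det2 G / g ^+ 2)).
    by rewrite /t/= /a /det2 sG; field.
  by rewrite s1 mul1r gE divff ?mulr1// -gE expf_neq0.
by field.
Qed.

(** * The optimal parameter and the Holevo bound *)

Let zero01 : 0 <= (0 : R) <= 1. Proof. by rewrite lexx ler01. Qed.
Let one01 : 0 <= (1 : R) <= 1. Proof. by rewrite lexx ler01. Qed.

Lemma betahat_frame : betahat G rho D = (2 * h) / (2 * a).
Proof.
rewrite (betahatE G (invmx_Jbeta_frame zero01) (invmx_Jbeta_frame one01)).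
rewrite trnorm_skew//; last exact/herm_ImM_skew/frame_inv_herm.
have -> : Defs.ImM (frame_inv 1) 0 1 = Im (W 0 1).
  by rewrite [LHS]mxE [frame_inv 1 0 1]mxE /= mul1r.
rewrite -/g -mulrA -/h; have [sG _ _ _] := rposdef2 G_pos.
have dE j k : Re ((frame_inv 0 - RtoC (Defs.ReM (frame_inv 1))) j k) = q j * q k.
  by rewrite !mxE /=; ring.
by rewrite Re_mxtrace_RtoC !dE sG; congr (_ / (2 * _)); rewrite /a; ring.
Qed.

Lemma frame_quad_gt0 : q 0 != 0 \/ q 1 != 0 -> 0 < a.
Proof.
move=> q0; have [sG _ _ _] := rposdef2 G_pos.
have := G_pos.2 (cvec2 (q 0) (q 1)); rewrite quad_form_cvec2 sG.
rewrite cvec2_neq0; last by apply/orP.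
by move=> /(_ isT); rewrite /a; congr (_ < _); ring.
Qed.

(** The inverse of [J^(S)] minus the real part of the inverse of [J^(R)] is [q q^T], which vanishes
    exactly when [q] does, and so when [a] does, [G] being positive definite. *)
Lemma betahat_finite_frame : if betahat_finite rho D then 0 < a else a == 0.
Proof.
rewrite (betahat_finiteE (invmx_Jbeta_frame zero01) (invmx_Jbeta_frame one01)).
case: ifPn => [ne|]; last rewrite negbK => /eqP/matrixP eq.
  apply: frame_quad_gt0; apply: contrapT => /not_orP[/negP q0 /negP q1].
  move: q0 q1; rewrite !negbK => /eqP q0 /eqP q1.
  have qE : forall k, q k = 0 by elim/ord2_ind.
  move/eqP: ne; apply; apply/matrixP => i j; rewrite !mxE !qE /=.
  by apply/eqP; rewrite eq_complex/= !mul0r !mulr0 !eqxx.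
have qq k : q k = 0.
  have := eq k k; rewrite !mxE /= => -[/eqP]; rewrite expr0n mul0r subr0 expr1n mul1r.
  rewrite eq_sym -subr_eq0 addrAC subrr add0r oppr_eq0 mulf_eq0 orbb.
  by move/eqP.
by apply/eqP; rewrite /a !qq; ring.
Qed.

(** Optimality conditions for the parabola on the unit interval: either its vertex [h / a], or the
    endpoint 1 when the vertex lies at or beyond it or when [a = 0]. *)
Lemma betastarP (b := betastar G rho D) :
  [/\ 0 <= b <= 1, b * a <= h & b = 1 \/ b * a = h].
Proof.
have h0 : 0 <= h by rewrite mulr_ge0 ?sqrtr_ge0.
have := betahat_finite_frame; rewrite /b /betastar betahat_frame.
case: ifP => _ /= => [a0|/eqP a0]; last first.
  by rewrite a0 mulr0 ler01 lexx; split; [|exact: h0|left].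
have haE : 2 * h / (2 * a) = h / a by field; rewrite gt_eqF.
rewrite haE; case: ltP => ha.
  have e : h / a * a = h by rewrite divfK// gt_eqF.
  by rewrite e; split; [rewrite divr_ge0 ?(ltW a0)//= ltW| |right].
by rewrite one01 mul1r; split=> //; [move: ha; rewrite ler_pdivlMr// mul1r|left].
Qed.

Lemma holevo_bound_frame (Cstar := Cbeta G rho D (betastar G rho D)) :
  is_holevo_bound G rho D Cstar /\
  (exists b, 0 <= b <= 1 /\ Cbeta G rho D b = Cstar) /\
  (forall b, 0 <= b <= 1 -> Cbeta G rho D b <= Cstar).
Proof.
rewrite /Cstar; have [] := betastarP; set b := betastar G rho D => b01 bah bE.
split; [split|split].
- have [B [feasB objB]] := holevo_obj_attained bah.
  exists B; split=> //; rewrite objB Cbeta_frame//.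
  (* The attained value exceeds [Cbeta] at [b] by [2 (1 - b) (h - b a)], which is zero in either
     case. *)
  by case: bE => [->|<-]; ring.
- by move=> B; exact: Cbeta_le_holevo_obj.
- by exists b.
(* The gap factors through [b - b']: at [b = 1] both factors are nonnegative, and at the vertex the
   gap is [a (b - b')^2]. *)
- move=> b' b'01; rewrite !Cbeta_frame// -subr_ge0.
  rewrite [leRHS](_ : _ = (b - b') * (2 * h - a * (b + b'))); last by ring.
  have a0 : 0 <= a by have := betahat_finite_frame; case: ifP => _ => [/ltW|/eqP->].
  case/andP: b'01 => b'0 b'1; case: bE bah => [->|<- _].
    move=> ah; apply: mulr_ge0; first by rewrite subr_ge0.
    by nra.
  have -> : (b - b') * (2 * (b * a) - a * (b + b')) = a * (b - b') ^+ 2 by ring.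
  by rewrite mulr_ge0// sqr_ge0.
Qed.

End Frame.

Theorem theorem7 (R : realType) (d : nat) (Theta : set (R * R))
    (rho : R * R -> 'M[R[i]]_d) (th0 : R * R) (D : 'I_2 -> 'M[R[i]]_d) :
  open Theta -> Theta th0 ->
  (forall th, Theta th -> density (rho th)) ->
  (forall i, has_partial rho th0 i (D i)) ->
  posdef (rho th0) ->
  rlin_indep (Lbeta (rho th0) D 0) ->
  (exists T : 'I_3 -> 'M[R[i]]_d,
      (forall k, is_herm (T k)) /\ rlin_indep T /\
      (forall i, in_rspan T (Lbeta (rho th0) D 0 i)) /\
      (forall X, in_rspan T X -> in_rspan T (Dcomm (rho th0) X))) ->
  forall G : 'M[R]_2, rposdef G ->
  let Cstar := Cbeta G (rho th0) D (betastar G (rho th0) D) in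
  is_holevo_bound G (rho th0) D Cstar /\
  (exists b, 0 <= b <= 1 /\ Cbeta G (rho th0) D b = Cstar) /\
  (forall b, 0 <= b <= 1 -> Cbeta G (rho th0) D b <= Cstar).
Proof.
move=> _ _ _ _ rho_pos indL [T [hT [indT [LT DT]]]] G G_pos.
have [E [E3 [[hE hE3] dualE DE3 [E33 E3E] LamE]]] :=
  adapted_frame rho_pos hT indT indL LT DT.
(* Each [D i] is the image under [Lam rho 0] of an SLD, which lies in a real span of Hermitian
   operators. *)
have hD i : is_herm (D i).
  rewrite -(@Lam_Lbeta _ _ _ 0 rho_pos _ D i); last by rewrite lexx ler01.
  by apply: (herm_Lam0 rho_pos.1); exact: (herm_rspan hT).
exact: (holevo_bound_frame rho_pos hD hE hE3 dualE DE3 E33 E3E LamE G_pos).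
Qed.
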